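(* Define the termination rates of subchain $j$ by $$\Delta q^j_{k,k'}=q^j_k\,\hat\pi^{-j}_{k'},\qquad k,k'\in\partial A_j.$$ Then the following two flow conservation conditions hold at all boundary states: (1) (outflow) $\displaystyle\sum_{k'\in A_j^c}q_{k,k'}=\sum_{k'\in\partial A_j}\Delta q^j_{k,k'}$ for all $k\in\partial A_j$; (2) (inflow) $\displaystyle\sum_{k'\in A_j^c}\pi_{k'}q_{k',k}=\sum_{k'\in\partial A_j}\pi_{k'}\Delta q^j_{k',k}$ for all $k\in\partial A_j$. Consequently, partial flow is conserved: $$\pi_k\sum_{k'\in A_j^c}q_{k,k'}-\sum_{k'\in A_j^c}\pi_{k'}q_{k',k}=\pi_k\sum_{k'\in\partial A_j}\Delta q^j_{k,k'}-\sum_{k'\in\partial A_j}\pi_{k'}\Delta q^j_{k',k}\quad\text{for all }k\in\partial A_j.$$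
   Context: Consider an ergodic (irreducible, positive recurrent) continuous-time Markov chain (the full MC) on a countable state space $S$, with transition rate $q_{k,k'}$ from state $k$ to state $k'\neq k$ and stationary distribution $(\pi_k)_{k\in S}$. Let $A_j$ be a nonempty proper subset of $S$ and $A_j^c=S\setminus A_j$. The boundary set of $A_j$ is $$\partial A_j=\{k\in A_j:\ q_{k,k'}+q_{k',k}>0\text{ for some }k'\in A_j^c\}.$$ A termination of subchain $j$ is a choice of nonnegative rates $\Delta q^j_{k,k'}$, $k,k'\in\partial A_j$ (self-transitions $k=k'$ allowed), to be added to the rates of the chain restricted to $A_j$. Let $(\pi^{-j}_m)_{m\in A_j^c}$ be the correct distribution on $A_j^c$, i.e. the probability distribution proportional to $(\pi_m)_{m\in A_j^c}$. Define the total outflow rate from $k\in\partial A_j$ to $A_j^c$ by $q^j_k=\sum_{m\in A_j^c}q_{k,m}$, and the proportion of inflow to $k'\in\partial A_j$ from $A_j^c$ by $$\hat\pi^{-j}_{k'}=\frac{\sum_{m\in A_j^c}\pi^{-j}_m q_{m,k'}}{\sum_{k''\in\partial A_j}\sum_{m\in A_j^c}\pi^{-j}_m q_{m,k''}},$$ where the denominator is understood to be finite (so that the proportion is well defined; this is automatic for finite $S$). *)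

(* Defs.v *)
From HB Require Import structures.
From mathcomp Require Import all_boot all_order all_algebra.
From mathcomp Require Import all_classical all_reals all_analysis.
From mathcomp Require Import measurable_realfun.

Set Implicit Arguments.
Unset Strict Implicit.
Unset Printing Implicit Defensive.

Import Order.TTheory GRing.Theory Num.Theory.
Import numFieldNormedType.Exports.

Local Open Scope classical_set_scope.
Local Open Scope ring_scope.
Local Open Scope ereal_scope.

(* Sums over subsets of the countable state space are extended-real sums of
   nonnegative terms.  The diagonal entries [q k k] are never used. *)

Section Chain.
Context {R : realType} {S : countType}.
Implicit Types (q : S -> S -> R) (k : S).

Definition exit_rate q k : \bar R :=
  \esum_(k' in [set k' | k' <> k]) (q k k')%:E.

Definition transition_rates q : Prop :=
  (forall k k', k <> k' -> (0 <= q k k')%R) /\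
  (forall k, exit_rate q k < +oo).

Definition jump_prob q k k' : R :=
  if fine (exit_rate q k) == 0%R then (k == k')%:R
  else if k == k' then 0%R else (q k k' / fine (exit_rate q k))%R.

Context {d : measure_display} {Omega : measurableType d}.
Implicit Types (P : S -> probability Omega R) (Y : nat -> Omega -> S)
  (H : nat -> Omega -> \bar R).

(* The chain is given by its jump chain [Y] and its holding times [H]: it is in
   state [Y n] during the time interval [J_n, J_(n+1)[, where
   J_n = H 0 + ... + H (n - 1).  [P k] is the law of the chain started at [k].
   The finite-dimensional law below says that [Y] is a Markov chain with
   transition matrix [jump_prob q] started at [k] and that, given [Y], the
   holding times are independent, [H n] being exponential with parameter the
   exit rate of [Y n] (infinite if that rate is 0). *)
Record is_ctmc q P Y H : Prop := IsCTMC {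
  ctmc_rates : transition_rates q ;
  ctmc_measurable_jump : forall n k, measurable [set w | Y n w = k] ;
  ctmc_measurable_hold : forall n, measurable_fun setT (H n) ;
  ctmc_hold_gt0 : forall n w, 0 < H n w ;
  ctmc_law : forall k n (y : nat -> S) (t : nat -> R),
    (forall i, (0 <= t i)%R) ->
    P k [set w | forall i, (i <= n)%N -> Y i w = y i /\ (t i)%:E < H i w] =
    ((y 0%N == k)%:R
     * (\prod_(i < n) jump_prob q (y i) (y i.+1))
     * (\prod_(i < n.+1) expR (- (fine (exit_rate q (y i)) * t i))))%:E }.

Definition irreducible P Y : Prop :=
  forall k k', 0 < P k [set w | exists n, Y n w = k'].

(* The first time after the first jump at which the chain is in [k]: the least
   jump time J_n with n > 0 and Y n = k, and +oo if the chain never returns. *)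
Definition return_time Y H k (w : Omega) : \bar R :=
  ereal_inf [set \sum_(i < n) H i w | n in [set n | (0 < n)%N /\ Y n w = k]].

(* An absorbing state is positive recurrent by convention. *)
Definition positive_recurrent q P Y H : Prop :=
  forall k, exit_rate q k = 0 \/ \int[P k]_w return_time Y H k w < +oo.

Definition ergodic q P Y H : Prop :=
  irreducible P Y /\ positive_recurrent q P Y H.

(* A probability vector [pi] satisfying the global balance equations, that is,
   pi Q = 0 for the generator Q of the chain. *)
Definition stationary_distribution q (pi : S -> R) : Prop :=
  [/\ forall k, (0 <= pi k)%R,
      \esum_(k in [set: S]) (pi k)%:E = 1 &
      forall k, \esum_(k' in [set k' | k' <> k]) (pi k' * q k' k)%:E
                = (pi k)%:E * exit_rate q k].

End Chain.

Section Termination.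
Context {R : realType} {S : countType}.
Implicit Types (q : S -> S -> R) (pi : S -> R) (A : set S) (k m : S).

Definition boundary q A : set S :=
  [set k | A k /\ exists k', (~` A) k' /\ (0 < q k k' + q k' k)%R].

Definition correct_dist pi A m : R :=
  (pi m / fine (\esum_(i in ~` A) (pi i)%:E))%R.

Definition outflow_rate q A k : \bar R := \esum_(m in ~` A) (q k m)%:E.

Definition inflow q pi A k : \bar R :=
  \esum_(m in ~` A) (correct_dist pi A m * q m k)%:E.

Definition total_inflow q pi A : \bar R :=
  \esum_(k in boundary q A) inflow q pi A k.

Definition inflow_proportion q pi A k : R :=
  (fine (inflow q pi A k) / fine (total_inflow q pi A))%R.

Definition termination_rate q pi A k k' : R :=
  (fine (outflow_rate q A k) * inflow_proportion q pi A k')%R.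

End Termination.

(* Main.v *)
Require Import Defs.
From HB Require Import structures.
From mathcomp Require Import all_boot all_order all_algebra.
From mathcomp Require Import all_classical all_reals all_analysis.
From mathcomp Require Import measurable_realfun.

Set Implicit Arguments.
Unset Strict Implicit.
Unset Printing Implicit Defensive.

Import Order.TTheory GRing.Theory Num.Theory.
Import numFieldNormedType.Exports.

Local Open Scope classical_set_scope.
Local Open Scope ring_scope.
Local Open Scope ereal_scope.

(** Multiplying out the definition of the termination rates, condition (1) says
    that the inflow proportions sum to 1 over the boundary, and condition (2)
    says that the stationary flow out of [A] equals the stationary flow into
    [A]: summing [pi k' * outflow k'] over the boundary must cancel the total
    inflow in the denominator of the proportions.  The whole difficulty is thus
    the balance of flows across the cut, [stationary_flow_balance].

    When the sum of [pi k * exit_rate k] over [A] is finite, this follows by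
    summing the global balance equations over [A].  In general that sum may be
    infinite and the internal flow of [A] cannot be cancelled; for an explosive
    chain the balance can even fail.  Recurrence has to be used, as follows.

    Put [mu x = pi x * exit_rate x].  Global balance says that [mu] is an
    invariant measure of the jump chain.  Fix a state [o] outside [A], and let
    [excursion o x] be the expected number of visits to [x] during an excursion
    of the jump chain from [o] to its first return to [o].  During each
    excursion the chain enters and leaves [A] equally often, so the excursion measure has
    balanced flows ([flow_excursion]).  The excursion measure is invariant
    because the chain returns to [o] ([invariant_excursion]), it is the least
    invariant measure with value 1 at [o] ([excursion_le]), and irreducibility
    turns this comparison into the equality [mu x = mu o * excursion o x]
    ([invariant_excursionE]).  So [mu] has balanced flows ([flow_balance]).

    These arguments concern a stochastic matrix.  The law of the chain gives the
    two facts that they need about the matrix of jump probabilities: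
    irreducibility ([irreducible_jump]), and recurrence ([recurrent_jump]),
    because a finite mean return time forces an almost sure return.  Both come
    from [avoids_follows_law], which identifies the iterates of the matrix with a
    forbidden set as probabilities of events of the jump chain. *)

(** * Sums of nonnegative extended reals *)

Section EsumTheory.
Context {R : realType}.

(** The inequality [<=] holds termwise on finite sums.  For a positive real
    factor, applying it to the inverse factor gives the converse; an infinite
    factor makes the sum infinite as soon as one term is nonzero. *)
Lemma ge0_esum_distrr (T : choiceType) (I : set T) (c : \bar R)
    (f : T -> \bar R) :
  0 <= c -> (forall i, I i -> 0 <= f i) ->
  \esum_(i in I) (c * f i) = c * \esum_(i in I) f i.
Proof.
have le_distr (d : \bar R) (g : T -> \bar R) : 0 <= d ->
    (forall i, I i -> 0 <= g i) ->
    \esum_(i in I) (d * g i) <= d * \esum_(i in I) g i.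
  move=> d0 g0; apply: ge_ereal_sup => _ [X [finX XI]] <-.
  rewrite fsbig_finite//= big_seq -ge0_sume_distrr; last first.
    by move=> i; rewrite in_fset_set// => /set_mem /XI /g0.
  rewrite lee_wpmul2l// -big_seq -fsbig_finite//.
  by apply: ereal_sup_ubound; exists X.
move=> c0 f0; apply/eqP; rewrite eq_le le_distr//=.
case: c c0 => [r r_ge0|_|//]; last first.
  have [f_all0|] := pselect (forall i, I i -> f i = 0).
    by rewrite esum1// mule0; apply: esum_ge0 => i Ii; rewrite f_all0// mule0.
  move/existsNP => [i /not_implyP[Ii /eqP fi0]].
  suff -> : \esum_(j in I) (+oo * f j) = +oo by rewrite leey.
  apply/eqP; rewrite -leye_eq; apply: esum_ge.
  exists [set i]; first by split=> // j ->.
  by rewrite fsbig_set1 gt0_mulye// lt0e fi0 f0.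
have [->|rN0] := eqVneq r 0%R.
  by rewrite mul0e; apply: esum_ge0 => i Ii; rewrite mul0e.
have r0 : (0 < r)%R by rewrite lt0r rN0 -lee_fin.
rewrite -[leRHS]mul1e -(mulfV rN0) EFinM -muleA.
rewrite lee_wpmul2l ?lee_fin ?(ltW r0)//.
rewrite (_ : esum I f = \esum_(i in I) (r^-1%:E * (r%:E * f i))).
  apply: le_distr; first by rewrite lee_fin invr_ge0 ltW.
  by move=> i Ii; rewrite mule_ge0 ?lee_fin ?(ltW r0)// f0.
apply: eq_esum => i _.
by rewrite muleA -EFinM mulVf// mul1e.
Qed.

Lemma ge0_esum_distrl (T : choiceType) (I : set T) (c : \bar R)
    (f : T -> \bar R) :
  0 <= c -> (forall i, I i -> 0 <= f i) ->
  \esum_(i in I) (f i * c) = (\esum_(i in I) f i) * c.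
Proof.
move=> c0 f0; rewrite muleC -ge0_esum_distrr//.
by apply: eq_esum => i _; rewrite muleC.
Qed.

Lemma exchange_esum (T U : choiceType) (I : set T) (J : set U)
    (f : T -> U -> \bar R) :
  (forall i j, I i -> J j -> 0 <= f i j) ->
  \esum_(i in I) \esum_(j in J) f i j = \esum_(j in J) \esum_(i in I) f i j.
Proof.
move=> f0; rewrite !esum_esum//; last by move=> j i Jj Ii; exact: f0.
rewrite (reindex_esum (J `*` I) _ (fun x => (x.2, x.1)))//.
split=> [[i j] []//||[i j] [Ii Jj]]; last by exists (j, i).
by move=> [i j] [i' j'] _ _ /= [-> ->].
Qed.

Lemma esum_gt0 (T : choiceType) (I : set T) (f : T -> \bar R) i :
  (forall j, I j -> 0 <= f j) -> I i -> 0 < f i -> 0 < \esum_(j in I) f j.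
Proof.
move=> f0 Ii fi; apply: (lt_le_trans fi); apply: esum_ge.
by exists [set i]; [split=> // j ->|rewrite fsbig_set1].
Qed.

Lemma term_le_esum (T : choiceType) (I : set T) (f : T -> \bar R) i :
  I i -> f i <= \esum_(j in I) f j.
Proof.
by move=> Ii; apply: esum_ge; exists [set i]; [split=> // j ->|rewrite fsbig_set1].
Qed.

Lemma term_eq0_esum (T : choiceType) (I : set T) (f : T -> \bar R) i :
  (forall j, I j -> 0 <= f j) -> \esum_(j in I) f j = 0 -> I i -> f i = 0.
Proof.
move=> f0 s0 Ii; apply/eqP; rewrite eq_le f0// andbT -s0; exact: term_le_esum.
Qed.

Lemma esum_single (T : choiceType) (f : T -> \bar R) (a : T) :
  0 <= f a -> (forall x, x <> a -> f x = 0) -> \esum_(x in [set: T]) f x = f a.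
Proof.
move=> fa0 f0; have f_ge0 x : 0 <= f x.
  by have [->//|/eqP xa] := eqVneq x a; rewrite f0.
rewrite (esumID [set a])// setTI esum_set1// esum1 ?adde0//.
by move=> x [_ /= xa]; exact: f0.
Qed.

(** Termwise comparison rigidity: a strict inequality between two terms could
    not be compensated elsewhere, as the sums are finite. *)
Lemma eq_term_esum (T : choiceType) (I : set T) (f g : T -> \bar R) i :
  (forall j, I j -> 0 <= f j <= g j) -> \esum_(j in I) f j \is a fin_num ->
  \esum_(j in I) f j = \esum_(j in I) g j -> I i -> f i = g i.
Proof.
move=> fg ffin e Ii; have f0 j : I j -> 0 <= f j by move=> /fg /andP[].
have g0 j : I j -> 0 <= g j by move=> /fg /andP[]; exact: le_trans.
move: e ffin; rewrite (esumID [set i])// [in RHS](esumID [set i])//.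
rewrite (_ : I `&` [set i] = [set i]); last by apply/seteqP; split=> [j []//|j /= ->].
rewrite !esum_set1 ?f0 ?g0//.
set s := esum _ f; set t := esum _ g => e.
have st : s <= t by apply: le_esum => j [/fg /andP[]].
have s0 : 0 <= s by apply: esum_ge0 => j [/f0].
rewrite fin_numD => /andP[fi sfin].
have /andP[_ fgi] := fg _ Ii.
apply/eqP; rewrite eq_le fgi/= -(@leeD2rE _ s)// e leeD2l//.
Qed.

End EsumTheory.

(** * Invariant measures of recurrent stochastic matrices *)

Section TransitionMatrix.
Context {R : realType} {S : countType}.
Implicit Types (p : S -> S -> \bar R) (mu a : S -> \bar R) (A Z : set S).
Implicit Types (x y o : S) (n : nat).

(** The row vector [a] times the matrix [p]. *)
Definition push p a y : \bar R := \esum_(x in [set: S]) (a x * p x y).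

(** The [n]-step transition weights from [o] when the steps [1, .., n] are
    forbidden to land in [Z]; the starting point itself may lie in [Z]. *)
Fixpoint taboo Z p o n y : \bar R :=
  match n with
  | 0%N => (o == y)%:R%:E
  | n'.+1 => if y \in Z then 0 else push p (taboo Z p o n') y
  end.

Definition stochastic p : Prop :=
  (forall x y, 0 <= p x y) /\ forall x, \esum_(y in [set: S]) p x y = 1.

(** Irreducibility in closed-set form: a nonempty set containing all its
    predecessors is everything.  This avoids any mention of paths and is the
    form in which irreducibility is used. *)
Definition irreducible_matrix p : Prop :=
  forall Z, Z !=set0 -> (forall x y, Z y -> 0 < p x y -> Z x) -> Z = [set: S].

(** The sum is the probability that the chain started at [o] has not come back
    to [o] by time [n]. *)
Definition recurrent_matrix p : Prop :=
  forall o, (fun n => \esum_(y in [set: S]) taboo [set o] p o n y) @ \oo --> 0.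

Definition invariant p mu : Prop := forall y, push p mu y = mu y.

(** Expected number of visits to [y] before the first return to [o], counting
    the start and not the return. *)
Definition excursion p o y : \bar R := \sum_(n <oo) taboo [set o] p o n y.

Definition flow p mu A B : \bar R :=
  \esum_(x in A) \esum_(y in B) (mu x * p x y).

Section Theory.
Variable p : S -> S -> \bar R.
Hypothesis p_stoch : stochastic p.

Let p_ge0 x y : 0 <= p x y. Proof. by case: p_stoch => + _; exact. Qed.
Let p_sum1 x : \esum_(y in [set: S]) p x y = 1.
Proof. by case: p_stoch => _; exact. Qed.

Lemma push_ge0 a y : (forall x, 0 <= a x) -> 0 <= push p a y.
Proof. by move=> a0; apply: esum_ge0 => x _; rewrite mule_ge0. Qed.

Lemma taboo_ge0 Z o n y : 0 <= taboo Z p o n y.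
Proof.
elim: n y => [|n IHn] y /=; first by rewrite lee_fin.
by case: ifP => // _; exact: push_ge0.
Qed.
Hint Resolve taboo_ge0 : core.

Lemma le_push a b y : (forall x, a x <= b x) -> push p a y <= push p b y.
Proof. by move=> ab; apply: le_esum => x _; rewrite lee_wpmul2r. Qed.

Lemma pushZ c a y : 0 <= c -> (forall x, 0 <= a x) ->
  push p (fun x => c * a x) y = c * push p a y.
Proof.
move=> c0 a0; rewrite -ge0_esum_distrr//; last by move=> x _; rewrite mule_ge0.
by apply: eq_esum => x _; rewrite muleA.
Qed.

Lemma push_sum (a : nat -> S -> \bar R) n y : (forall i x, 0 <= a i x) ->
  push p (fun x => \sum_(0 <= i < n) a i x) y =
  \sum_(0 <= i < n) push p (a i) y.
Proof.
move=> a0; rewrite -esum_sum; last by move=> x i _ _; rewrite mule_ge0.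
by apply: eq_esum => x _; rewrite ge0_sume_distrl.
Qed.

Lemma push_series (a : nat -> S -> \bar R) y : (forall i x, 0 <= a i x) ->
  push p (fun x => \sum_(i <oo) a i x) y = \sum_(i <oo) push p (a i) y.
Proof.
move=> a0; rewrite nneseries_esumT; last by move=> i; exact: push_ge0.
rewrite -exchange_esum; last by move=> x i _ _; rewrite mule_ge0.
apply: eq_esum => x _; rewrite ge0_esum_distrl//.
by rewrite -nneseries_esumT.
Qed.

Lemma push_mass a : (forall x, 0 <= a x) ->
  \esum_(y in [set: S]) push p a y = \esum_(x in [set: S]) a x.
Proof.
move=> a0; rewrite exchange_esum; last by move=> y x _ _; rewrite mule_ge0.
by apply: eq_esum => x _; rewrite ge0_esum_distrr// p_sum1 mule1.
Qed.

Lemma mass_dirac Z o : \esum_(y in [set: S]) taboo Z p o 0 y = 1.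
Proof.
rewrite (@esum_single _ _ _ o)//= ?eqxx// => x xo.
by case: eqP => // ox; case: xo.
Qed.

(** A path that has avoided [o] so far either avoids it once more or returns
    now.  The two events are kept on the same side so that no finiteness is
    involved. *)
Lemma taboo_mass_step o n :
  \esum_(y in [set: S]) taboo [set o] p o n.+1 y
    + push p (taboo [set o] p o n) o =
  \esum_(y in [set: S]) taboo [set o] p o n y.
Proof.
rewrite -[RHS]push_mass// [RHS](esumID [set o]); last first.
  by move=> y _; exact: push_ge0.
rewrite !setTI esum_set1; last exact: push_ge0.
rewrite addeC; congr (_ + _); rewrite [RHS]esum_mkcond.
apply: eq_esum => y _ /=; rewrite in_setC; by case: (y \in [set o]).
Qed.

Lemma excursion_self o : excursion p o o = 1.
Proof.
rewrite /excursion nneseries_recl// eseries0 ?adde0 /= ?eqxx//.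
by move=> [|n]//= _ _; rewrite mem_set.
Qed.

Lemma push_excursion_neq o y : y <> o ->
  push p (excursion p o) y = excursion p o y.
Proof.
move=> yo; rewrite push_series// /excursion [RHS]nneseries_recl//=.
case: eqP => [oy|_]; first by case: yo.
rewrite add0e -(@nneseries_addn _ _ 1%N); last by move=> i; exact: taboo_ge0.
by apply: eq_eseriesr => n _; rewrite addn1 /= memNset.
Qed.

(** This is where recurrence enters: the probabilities of first returning at
    time [n.+1] telescope to 1 minus the probability of not having returned. *)
Lemma push_excursion_self o : recurrent_matrix p ->
  push p (excursion p o) o = 1.
Proof.
move=> /(_ o) mass0; rewrite push_series//.
set m := fun n : nat => _ in mass0.
set s := fun n => \sum_(0 <= i < n) push p (taboo [set o] p o i) o.
have sm n : s n + m n = 1.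
  elim: n => [|n IHn]; first by rewrite /s big_nil add0e; exact: mass_dirac.
  by rewrite /s big_nat_recr//= -IHn /m -(taboo_mass_step o n) addeAC addeA.
have m_ge0 n : 0 <= m n by apply: esum_ge0.
have s_ge0 n : 0 <= s n by apply: sume_ge0 => i _; exact: push_ge0.
have cs : cvgn s.
  by apply: is_cvg_ereal_nneg_natsum => i _; exact: push_ge0.
have : (fun n => s n + m n) @ \oo --> limn s + 0.
  by apply: cvgeD => //; rewrite fin_num_adde_defl.
rewrite adde0 (_ : (fun n => _) = cst 1); last exact/funext.
by move/cvg_unique => /(_ (@ereal_hausdorff _)); apply; exact: cvg_cst.
Qed.

Lemma invariant_excursion o : recurrent_matrix p -> invariant p (excursion p o).
Proof.
move=> rec y; have [->|/eqP yo] := eqVneq y o.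
  by rewrite push_excursion_self// excursion_self.
exact: push_excursion_neq.
Qed.

Lemma excursion_ge0 o y : 0 <= excursion p o y.
Proof. exact: nneseries_ge0. Qed.

(** Each partial sum of [mu o * excursion p o] is bounded by [mu], since it is
    obtained from the previous one by one step of the matrix, which preserves
    [mu], and by resetting the value at [o] to [mu o]. *)
Lemma excursion_le mu o y : (forall x, 0 <= mu x) -> invariant p mu ->
  mu o * excursion p o y <= mu y.
Proof.
move=> mu0 muP.
have fin n x : mu o * \sum_(0 <= i < n) taboo [set o] p o i x <= mu x.
  elim: n x => [|n IHn] x; first by rewrite big_nil mule0.
  rewrite big_nat_recl//=; have [<-|/eqP ox] := eqVneq o x.
    by rewrite big1 ?adde0 ?mule1// => i _; rewrite mem_set.
  rewrite add0e (eq_bigr (fun i => push p (taboo [set o] p o i) x)); last first.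
    by move=> i _; rewrite memNset//= => xo; case: ox.
  rewrite -push_sum// -pushZ//; last by move=> z; exact: sume_ge0.
  by rewrite -[leRHS]muP; exact: le_push.
rewrite /excursion nneseries_esumT// -ge0_esum_distrr//.
rewrite -nneseries_esumT; last by move=> i; rewrite mule_ge0.
apply: lime_le; first by apply: is_cvg_nneseries => i _ _; rewrite mule_ge0.
by apply: nearW => n; rewrite -ge0_sume_distrr.
Qed.

(** The two invariant measures [mu o * excursion p o] and [mu] are comparable
    and agree at [o].  If they agree at [z], invariance at [z] makes them agree
    at every predecessor of [z], and irreducibility concludes. *)
Lemma invariant_excursionE mu o y : irreducible_matrix p ->
  recurrent_matrix p ->
  (forall x, 0 <= mu x) -> (forall x, mu x \is a fin_num) -> invariant p mu ->
  mu y = mu o * excursion p o y.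
Proof.
move=> irr rec mu0 mufin muP.
pose nu x := mu o * excursion p o x.
have nu0 x : 0 <= nu x by rewrite mule_ge0// excursion_ge0.
have nu_le x : nu x <= mu x by exact: excursion_le.
have nufin x : nu x \is a fin_num by rewrite ge0_fin_numE// (le_lt_trans (nu_le x))// -ge0_fin_numE.
have nuP z : push p nu z = nu z.
  rewrite pushZ//; first by rewrite invariant_excursion.
  by move=> x; exact: excursion_ge0.
suff : [set x | nu x = mu x] = [set: S].
  by move/seteqP => [_ /(_ y I)] /=.
apply: irr; first by exists o; rewrite /= /nu excursion_self mule1.
move=> x z /= nuz pxz.
have : nu x * p x z = mu x * p x z.
  apply: (@eq_term_esum _ _ [set: S] (fun t => nu t * p t z)
                                    (fun t => mu t * p t z)) => //.
  - by move=> t _; rewrite mule_ge0//= lee_wpmul2r.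
  - by rewrite -/(push p nu z) nuP.
  - by rewrite -/(push p nu z) -/(push p mu z) nuP muP.
have pfin : p x z \is a fin_num.
  rewrite ge0_fin_numE//; apply: le_lt_trans (ltry 1).
  by rewrite -(p_sum1 x); exact: term_le_esum.
move=> e; apply/eqP.
by rewrite eq_le nu_le/= -(@lee_pmul2r _ (p x z))// e.
Qed.

Lemma flow_series (a : nat -> S -> \bar R) A B : (forall i x, 0 <= a i x) ->
  flow p (fun x => \sum_(i <oo) a i x) A B = \sum_(i <oo) flow p (a i) A B.
Proof.
move=> a0; have f0 i x y : 0 <= a i x * p x y by rewrite mule_ge0.
have g0 i : 0 <= flow p (a i) A B.
  by apply: esum_ge0 => x _; apply: esum_ge0.
rewrite nneseries_esumT//.
rewrite -exchange_esum; last by move=> x i _ _; exact: esum_ge0.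
apply: eq_esum => x _; rewrite -exchange_esum//; apply: eq_esum => y _.
by rewrite ge0_esum_distrl// -nneseries_esumT.
Qed.

Lemma flowZ c a A B : 0 <= c -> (forall x, 0 <= a x) ->
  flow p (fun x => c * a x) A B = c * flow p a A B.
Proof.
move=> c0 a0; have f0 x y : 0 <= a x * p x y by rewrite mule_ge0.
rewrite -ge0_esum_distrr//; last by move=> x _; apply: esum_ge0.
apply: eq_esum => x _; rewrite -ge0_esum_distrr//.
by apply: eq_esum => y _; rewrite muleA.
Qed.

(** Conservation of mass in [A] during one step, written additively: the mass in
    [A] after the step is the mass before it, plus what enters, minus what
    leaves.  As [o] is outside [A], killing the chain at [o] does not affect the
    mass in [A]. *)
Lemma flow_taboo_step o A n : ~ A o ->
  let a := taboo [set o] p o in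
  flow p (a n) (~` A) A + \esum_(x in A) a n x =
  flow p (a n) A (~` A) + \esum_(x in A) a n.+1 x.
Proof.
move=> Ao a; have f0 x y : 0 <= a n x * p x y by rewrite mule_ge0// taboo_ge0.
have -> : \esum_(x in A) a n x = flow p (a n) A A + flow p (a n) A (~` A).
  rewrite -esumD; last 2 first.
  - by move=> x _; exact: esum_ge0.
  - by move=> x _; exact: esum_ge0.
  apply: eq_esum => x _; rewrite -[LHS]mule1 -(p_sum1 x).
  by rewrite -ge0_esum_distrr ?taboo_ge0// (esumID A)// !setTI.
have -> : \esum_(x in A) a n.+1 x = flow p (a n) A A + flow p (a n) (~` A) A.
  rewrite /flow exchange_esum// [X in _ + X]exchange_esum//.
  rewrite -esumD; last 2 first.
  - by move=> x _; exact: esum_ge0.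
  - by move=> x _; exact: esum_ge0.
  apply: eq_esum => y Ay; rewrite /a /= memNset; last first.
    by move=> /= yo; apply: Ao; rewrite -yo.
  by rewrite /push (esumID A)// !setTI.
by rewrite addeCA [in RHS]addeCA; congr (_ + _); rewrite addeC.
Qed.

(** Summed over the first [n] steps, the conservation law shows that the inflow
    exceeds the outflow by the mass still in [A] at time [n], which is at most
    the probability of not having returned to [o] and so tends to 0. *)
Lemma flow_excursion o A : recurrent_matrix p -> ~ A o ->
  flow p (excursion p o) (~` A) A = flow p (excursion p o) A (~` A).
Proof.
move=> rec Ao; rewrite !flow_series//.
set a := taboo [set o] p o.
have f0 i B C : 0 <= flow p (a i) B C.
  by apply: esum_ge0 => x _; apply: esum_ge0 => y _; rewrite mule_ge0// taboo_ge0.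
have a0 n : 0 <= \esum_(x in A) a n x by apply: esum_ge0 => x _; exact: taboo_ge0.
have finite_flow n : \sum_(0 <= i < n) flow p (a i) (~` A) A =
    \sum_(0 <= i < n) flow p (a i) A (~` A) + \esum_(x in A) a n x.
  elim: n => [|n IHn].
    rewrite !big_nil add0e esum1// => x Ax.
    by rewrite /a/=; case: eqP => // ox; case: Ao; rewrite ox.
  rewrite !big_nat_recr//= IHn -addeA -addeA; congr (_ + _).
  by rewrite addeC; exact: flow_taboo_step.
have an_cvg0 : (fun n => \esum_(x in A) a n x) @ \oo --> 0.
  apply: (squeeze_cvge _ (cvg_cst 0) (rec o)); apply: nearW => n; rewrite a0/=.
  rewrite [leLHS]esum_mkcond; apply: le_esum => x _.
  by case: ifP => // _; exact: taboo_ge0.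
have out_cvg : cvgn (fun n => \sum_(0 <= i < n) flow p (a i) A (~` A)).
  by apply: is_cvg_nneseries.
have : (fun n => \sum_(0 <= i < n) flow p (a i) A (~` A)
    + \esum_(x in A) a n x) @ \oo --> \sum_(i <oo) flow p (a i) A (~` A) + 0.
  by apply: cvgeD => //; rewrite fin_num_adde_defl.
rewrite adde0 -(funext finite_flow) => /cvg_lim; apply; exact: ereal_hausdorff.
Qed.

(** The reference state [o] must be chosen outside [A], which is what makes the
    mass in [A] vanish at both ends of an excursion. *)
Theorem flow_balance mu A : irreducible_matrix p -> recurrent_matrix p ->
  (forall x, 0 <= mu x) -> (forall x, mu x \is a fin_num) -> invariant p mu ->
  flow p mu (~` A) A = flow p mu A (~` A).
Proof.
move=> irr rec mu0 mufin muP.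
have [->|/eqP AT] := eqVneq A [set: S].
  rewrite /flow setCT esum_set0 esum1// => x _.
  by rewrite esum_set0.
have [x0 Ax0] : exists x, ~ A x.
  apply: contrapT => /forallNP allA; apply: AT.
  by apply/seteqP; split=> // x _; exact: contrapT.
have -> : mu = (fun x => mu x0 * excursion p x0 x).
  by apply/funext => x; exact: invariant_excursionE.
by rewrite !flowZ ?flow_excursion// => x; exact: excursion_ge0.
Qed.

End Theory.
End TransitionMatrix.

(** * Countably valued random variables and integrals *)

Section MeasureTheory.
Context {R : realType} {d : measure_display} {Omega : measurableType d}.

Lemma measurable_preimage_countable (S : countType) (X : Omega -> S)
    (B : set S) :
  (forall x, measurable [set w | X w = x]) -> measurable [set w | B (X w)].
Proof.
move=> mX.
rewrite (_ : [set _ | _] =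
    \bigcup_x (if x \in B then [set w | X w = x] else set0)).
  apply: countable_bigcupT_measurable => [|x]; first exact: countableP.
  by case: ifP.
apply/seteqP; split=> w /=.
  by move=> BXw; exists (X w) => //=; rewrite mem_set.
by move=> [x _]; case: ifP => // /set_mem Bx /= ->.
Qed.

(** Countable additivity over the fibers of [X], transported from [nat] to the
    countable type [S] by the encoding [pickle]. *)
Lemma measure_fibers (mu : {measure set Omega -> \bar R}) (S : countType)
    (X : Omega -> S) (E : set Omega) :
  (forall x, measurable [set w | X w = x]) -> measurable E ->
  mu E = \esum_(x in [set: S]) mu (E `&` [set w | X w = x]).
Proof.
move=> mX mE; pose F n := E `&` [set w | pickle (X w) = n].
have EF : E = \bigcup_n F n.
  by apply/seteqP; split=> [w Ew|w [n _ []]//]; exists (pickle (X w)).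
have mF n : measurable (F n).
  exact: measurableI mE (measurable_preimage_countable [set x | _ x = n] mX).
have tF : trivIset setT F.
  apply/trivIsetP => i j _ _ ij; apply/seteqP; split=> // w [[_ /= wi] [_ /= wj]].
  by rewrite -wi -wj eqxx in ij.
rewrite {1}EF measure_bigcup// nneseries_esum//.
rewrite (_ : [set x | _] = setT); last first.
  by apply/seteqP; split=> // x _ /=; rewrite in_setT.
rewrite (esumID (range (@pickle S)))// setTI.
rewrite [X in _ + X]esum1 ?adde0; last first.
  move=> n [_ nP]; rewrite (_ : F n = set0) ?measure0//.
  by apply/seteqP; split=> // w [_ /= wn]; apply: nP; exists (X w).
rewrite esum_image; last by move=> x y _ _; apply: pcan_inj; exact: pickleK.
apply: eq_esum => x _; congr (mu (_ `&` _)); apply/seteqP; split=> w /=.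
  by apply: pcan_inj; exact: pickleK.
by move=> ->.
Qed.

(** Monotonicity of the integral without measurability: the integral of a
    nonnegative function is a supremum over the simple functions below it.  It
    applies directly to the return time, an infimum over a random set. *)
Lemma ge0_le_integralT (mu : {measure set Omega -> \bar R})
    (f g : Omega -> \bar R) :
  (forall w, 0 <= f w) -> (forall w, f w <= g w) ->
  \int[mu]_w f w <= \int[mu]_w g w.
Proof.
move=> f0 fg; have g0 w : 0 <= g w by exact: le_trans (fg w).
rewrite !ge0_integralTE//; apply: ereal_sup_le => _ [h hf <-].
by exists h => // w; exact: le_trans (fg w).
Qed.

End MeasureTheory.

(** * The jump chain of an ergodic continuous-time chain *)

Section JumpChain.
Context {R : realType} {S : countType} (q : S -> S -> R).
Context {d : measure_display} {Omega : measurableType d}.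
Context {P : S -> probability Omega R} {Y : nat -> Omega -> S}.
Context {H : nat -> Omega -> \bar R}.
Hypothesis chainP : is_ctmc q P Y H.

Definition jump_matrix (x y : S) : \bar R := (jump_prob q x y)%:E.

Let rate_ge0 x y : x <> y -> (0 <= q x y)%R.
Proof. by case: chainP => -[r0 _] _ _ _ _; exact: r0. Qed.

Lemma exit_rate_ge0 x : 0 <= exit_rate q x.
Proof. by apply: esum_ge0 => y yx; rewrite lee_fin rate_ge0//; exact: nesym. Qed.

Lemma exit_rate_fin x : exit_rate q x \is a fin_num.
Proof.
by rewrite ge0_fin_numE ?exit_rate_ge0//; case: chainP => -[_ r] _ _ _ _; exact: r.
Qed.

Lemma jump_prob_ge0 x y : (0 <= jump_prob q x y)%R.
Proof.
rewrite /jump_prob; case: ifP => _; first by rewrite ler0n.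
case: eqP => // xy; rewrite divr_ge0 ?rate_ge0//.
by rewrite fine_ge0// exit_rate_ge0.
Qed.

(** When the exit rate is 0, both sides vanish: the rates out of [x] are the
    terms of a zero sum. *)
Lemma exit_rate_jump x y : x <> y ->
  exit_rate q x * jump_matrix x y = (q x y)%:E.
Proof.
move=> xy; rewrite /jump_matrix /jump_prob -{1}(fineK (exit_rate_fin x)) -EFinM.
case: (eqVneq (fine (exit_rate q x)) 0%R) => [e0|eN0]; last first.
  by case: eqP => // _; rewrite mulrC divfK.
rewrite e0 mul0r.
have ex0 : exit_rate q x = 0 by rewrite -(fineK (exit_rate_fin x)) e0.
have q0 := term_eq0_esum _ ex0 (nesym xy : [set z | z <> x] y).
apply/esym; rewrite q0// => z /nesym zx.
by rewrite lee_fin rate_ge0.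
Qed.

Lemma stochastic_jump : stochastic jump_matrix.
Proof.
split=> [x y|x]; first by rewrite lee_fin jump_prob_ge0.
have [e0|eN0] := eqVneq (fine (exit_rate q x)) 0%R.
  rewrite (@esum_single _ _ _ x) /jump_matrix /jump_prob e0 eqxx//.
    by rewrite eqxx.
  by move=> y yx; case: eqP => // xy; case: yx.
rewrite (esumID [set x]); last by move=> y _; rewrite lee_fin jump_prob_ge0.
rewrite !setTI esum_set1; last by rewrite lee_fin jump_prob_ge0.
rewrite {1}/jump_matrix /jump_prob (negbTE eN0) eqxx add0e.
have e0 : exit_rate q x != 0 by apply: contra_neq eN0 => ->.
have E : exit_rate q x * (\esum_(y in ~` [set x]) jump_matrix x y)
    = exit_rate q x.
  rewrite -ge0_esum_distrr ?exit_rate_ge0//; last first.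
    by move=> y _; rewrite lee_fin jump_prob_ge0.
  by apply: eq_esum => y /= yx; rewrite exit_rate_jump//; exact: nesym.
have egt0 : 0 < exit_rate q x by rewrite lt0e e0 exit_rate_ge0.
have cancel := lee_pmul2l (exit_rate_fin x) egt0.
by apply/eqP; rewrite eq_le -[X in X && _]cancel -[X in _ && X]cancel mule1 E lexx.
Qed.

Lemma jump_absorbing x y : exit_rate q x = 0 -> jump_matrix x y = (x == y)%:R%:E.
Proof. by move=> e0; rewrite /jump_matrix /jump_prob e0 eqxx. Qed.

Let mY n x : measurable [set w | Y n w = x].
Proof. by case: chainP. Qed.

(** Time 0 is left out, to match [taboo]. *)
Definition avoids (Z : set S) n : set Omega :=
  [set w | forall i, (0 < i <= n)%N -> ~ Z (Y i w)].

Definition follows (z : nat -> S) n m : set Omega :=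
  [set w | forall i, (i <= m)%N -> Y (n + i) w = z i].

Lemma measurable_avoids Z n : measurable (avoids Z n).
Proof.
rewrite (_ : avoids Z n =
    \bigcap_i (if (0 < i <= n)%N then [set w | (~` Z) (Y i w)] else setT)).
  apply: bigcapT_measurable => i; case: ifP => // _.
  exact: measurable_preimage_countable.
apply/seteqP; split=> [w wZ i _|w wZ i i_n].
  by case: ifP => // i_n; exact: wZ.
by have := wZ i I; rewrite i_n.
Qed.

Lemma measurable_follows z n m : measurable (follows z n m).
Proof.
rewrite (_ : follows z n m =
    \bigcap_i (if (i <= m)%N then [set w | Y (n + i) w = z i] else setT)).
  by apply: bigcapT_measurable => i; case: ifP.
apply/seteqP; split=> [w wz i _|w wz i im].
  by case: ifP => // im; exact: wz.
by have := wz i I; rewrite im.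
Qed.

(** The law of the chain at times [t i = 0], as holding times are positive. *)
Lemma follows_law k z m :
  P k (follows z 0 m) =
  (k == z 0%N)%:R%:E * (\prod_(i < m) jump_prob q (z i) (z i.+1))%:E.
Proof.
have [_ _ _ H0 /(_ k m z (fun=> 0%R) (fun=> lexx _)) law] := chainP.
transitivity (P k [set w | forall i, (i <= m)%N ->
    Y i w = z i /\ (0 : R)%:E < H i w]).
  congr (P k _); apply/seteqP; split=> w /= wz i im.
    by rewrite H0; split=> //; exact: wz.
  by have [] := wz _ im.
rewrite law [X in (_ * X)%R]big1 ?mulr1 ?EFinM ?(eq_sym k)//.
by move=> i _; rewrite mulr0 oppr0 expR0.
Qed.

(** The Markov property for the forbidden-set iterates.  The prescribed
    continuation [z] makes the induction go through: conditioning on the state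
    at time [n] prepends that state to [z], so only cylinders are ever
    evaluated. *)
Lemma avoids_follows_law k Z n z m :
  P k (avoids Z n `&` follows z n m) =
  taboo Z jump_matrix k n (z 0%N)
    * (\prod_(i < m) jump_prob q (z i) (z i.+1))%:E.
Proof.
elim: n z m => [|n IHn] z m.
  rewrite /= -follows_law; congr (P k _).
  by apply/seteqP; split=> [w []//|w wz]; split=> // i /andP[/leq_trans h /h].
rewrite /=; case: ifPn => [/set_mem Zz|/negP Zz].
  rewrite mul0e (_ : _ `&` _ = set0) ?measure0//.
  apply/seteqP; split=> // w [/(_ n.+1)]; rewrite /= leqnn => /(_ isT) nZ.
  by move=> /(_ 0%N isT); rewrite addn0 => e; apply: nZ; rewrite e.
have Zz0 : ~ Z (z 0%N) by move=> ?; apply: Zz; exact: mem_set.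
rewrite (measure_fibers _ (mY n)); last first.
  by apply: measurableI; [exact: measurable_avoids|exact: measurable_follows].
rewrite /push -ge0_esum_distrl; last 2 first.
- rewrite lee_fin; apply: prodr_ge0 => i _; exact: jump_prob_ge0.
- move=> x _; rewrite mule_ge0 ?lee_fin ?jump_prob_ge0//.
  exact: (taboo_ge0 stochastic_jump).
apply: eq_esum => x _.
(* the continuation [z] preceded by the state at time [n] *)
pose z' i := if i is i'.+1 then z i' else x.
rewrite -[taboo _ _ _ _ _ * _ * _]muleA -EFinM.
transitivity (P k (avoids Z n `&` follows z' n m.+1)).
  congr (P k _); apply/seteqP; split=> w /=.
    move=> [[wZ wz] wx]; split=> [i /andP[i0 i_n]|[|i] im].
    - by apply: wZ; rewrite i0 ltnW.
    - by rewrite addn0.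
    - by rewrite addnS -addSn; exact: wz.
  move=> [wZ wz]; split; [split|].
  - move=> i /andP[i0]; rewrite leq_eqVlt => /predU1P[->|i_n].
      by have := wz 1%N isT; rewrite addn1 => ->.
    by apply: wZ; rewrite i0.
  - by move=> i im; rewrite addSn -addnS; exact: (wz i.+1).
  - by have := wz 0%N isT; rewrite addn0.
by rewrite IHn big_ord_recl.
Qed.

Lemma avoids_law k Z n y :
  P k (avoids Z n `&` [set w | Y n w = y]) = taboo Z jump_matrix k n y.
Proof.
have := avoids_follows_law k Z n (fun=> y) 0.
rewrite big_ord0 mule1 => <-; congr (P k (_ `&` _)); apply/seteqP; split=> w /=.
  by move=> wy [|i]//= _; rewrite addn0.
by move=> /(_ 0%N isT); rewrite addn0.
Qed.

(** If [Z] contained all its predecessors but not [x], a chain started at [x]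
    could never enter [Z], so it would not hit the states of [Z]. *)
Lemma irreducible_jump : irreducible P Y -> irreducible_matrix jump_matrix.
Proof.
move=> irr Z [z Zz] Zpred; apply/seteqP; split=> // x _.
apply: contrapT => nZx.
have taboo0 n y : Z y -> taboo set0 jump_matrix x n y = 0.
  elim: n y => [|n IHn] y Zy /=.
    by case: eqP => // xy; case: nZx; rewrite xy.
  rewrite in_set0; apply: esum1 => t _.
  have [Zt|nZt] := pselect (Z t); first by rewrite IHn// mul0e.
  suff -> : jump_matrix t y = 0 by rewrite mule0.
  apply/eqP; rewrite eq_le [X in _ && X]lee_fin jump_prob_ge0 andbT leNgt.
  by apply/negP => /(Zpred _ _ Zy).
have hit0 n : P x [set w | Y n w = z] = 0.
  rewrite -(taboo0 n _ Zz) -avoids_law; congr (P x _).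
  by apply/seteqP; split=> [w wz|w []//]; split=> // i _ [].
have := irr x z; rewrite (_ : [set w | _] = \bigcup_n [set w | Y n w = z]).
  suff -> : P x (\bigcup_n [set w | Y n w = z]) = 0 by rewrite ltxx.
  apply: measure_negligible; first exact: bigcupT_measurable.
  apply: negligible_bigcup => n; by apply/negligibleP; [exact: mY|exact: hit0].
by apply/seteqP; split=> [w [n ?]|w [n _ ?]]; exists n.
Qed.

Lemma return_time_ge0 k w : 0 <= return_time Y H k w.
Proof.
apply: le_ereal_inf_tmp => _ [n _ <-]; apply: sume_ge0 => i _.
by apply: ltW; case: chainP.
Qed.

(** The return time is infinite on the event of no return, so this event is null
    when the mean return time is finite. *)
Lemma return_almost_surely k : exit_rate q k <> 0 ->
  positive_recurrent q P Y H -> P k (\bigcap_n avoids [set k] n) = 0.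
Proof.
move=> ek /(_ k) [//|ret_fin]; set F := \bigcap_n _.
have mF : measurable F by apply: bigcapT_measurable => n; exact: measurable_avoids.
have : \int[P k]_(w in F) cst +oo w < +oo.
  apply: le_lt_trans ret_fin; rewrite integral_mkcond.
  apply: ge0_le_integralT => w; first by apply: erestrict_ge0 => v _; exact: leey.
  rewrite patchE; case: ifP => [/set_mem Fw|_]; last exact: return_time_ge0.
  rewrite [leLHS]/= leye_eq; apply/eqP/ereal_inf_pinfty => y [n [n0 Ynk] _].
  by case: (Fw n I n); rewrite ?n0/=.
rewrite integral_cst//; have [-> //|PF0] := eqVneq (P k F) 0.
by rewrite gt0_mulye ?lt0e ?PF0 ?measure_ge0// ltxx.
Qed.

Lemma recurrent_jump : (forall k, exit_rate q k <> 0) ->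
  positive_recurrent q P Y H -> recurrent_matrix jump_matrix.
Proof.
move=> e0 rec k; rewrite -(return_almost_surely (e0 k) rec).
rewrite (_ : (fun n => _) = P k \o avoids [set k]).
  apply: nonincreasing_cvg_mu.
  - by rewrite (le_lt_trans (probability_le1 _ _)) ?ltry//; exact: measurable_avoids.
  - by move=> n; exact: measurable_avoids.
  - by apply: bigcapT_measurable => n; exact: measurable_avoids.
  - move=> m n mn; apply/subsetPset => w wn i /andP[i0 im]; apply: wn.
    by rewrite i0 (leq_trans im).
apply/funext => n /=; rewrite [RHS](measure_fibers _ (mY n)); last first.
  exact: measurable_avoids.
by apply: eq_esum => y _; exact: esym (avoids_law _ _ _ _).
Qed.

End JumpChain.

(** * Balance of the stationary flows across a cut *)

Section StationaryFlow.
Context {R : realType} {S : countType} (q : S -> S -> R).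
Context {d : measure_display} {Omega : measurableType d}.
Context {P : S -> probability Omega R} {Y : nat -> Omega -> S}.
Context {H : nat -> Omega -> \bar R}.
Hypothesis chainP : is_ctmc q P Y H.
Hypothesis ergP : ergodic q P Y H.
Context (pi : S -> R).
Hypothesis piP : stationary_distribution q pi.

(** The stationary measure of the jump chain: [pi] weights a state by the time
    spent in it, and the exit rate converts this time into a number of visits. *)
Definition jump_measure (x : S) : \bar R := (pi x)%:E * exit_rate q x.

Let p := jump_matrix q.
Let irr : irreducible_matrix p.
Proof. by apply: (irreducible_jump chainP); case: ergP. Qed.
Let pi_ge0 x : (0 <= pi x)%R. Proof. by case: piP. Qed.

Lemma jump_measure_ge0 x : 0 <= jump_measure x.
Proof. by rewrite mule_ge0 ?lee_fin ?(exit_rate_ge0 chainP). Qed.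

Lemma jump_measure_flow x y : x <> y ->
  jump_measure x * p x y = (pi x * q x y)%:E.
Proof.
by move=> xy; rewrite -muleA (exit_rate_jump chainP xy) EFinM.
Qed.

(** An absorbing state [x] is a predecessor of itself only, so the complement of
    [x] contains all its predecessors and irreducibility would empty [x]. *)
Lemma exit_rate_neq0 x y : x <> y -> exit_rate q x <> 0.
Proof.
move=> xy ex0; suff : ([set z | z <> x] : set S) = setT.
  by move=> /seteqP[_ /(_ x I)].
apply: irr; first by exists y; exact: nesym.
move=> u v /= vx + ux; rewrite ux /p jump_absorbing//.
by case: eqP => [xv|]; [case: vx|rewrite ltxx].
Qed.

Lemma invariant_jump_measure : (forall x, exit_rate q x <> 0) ->
  invariant p jump_measure.
Proof.
move=> e0 y; rewrite /push (esumID [set y]); last first.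
  move=> x _; rewrite mule_ge0 ?jump_measure_ge0//.
  by rewrite lee_fin (jump_prob_ge0 chainP).
have pyy : p y y = 0.
  rewrite /p /jump_matrix /jump_prob eqxx; case: eqP => // e.
  by case: (e0 y); rewrite -(fineK (exit_rate_fin chainP y)) e.
rewrite !setTI esum_set1 pyy mule0// add0e.
case: piP => _ _ bal; rewrite {2}/jump_measure -bal; apply: eq_esum => x /= xy.
exact: jump_measure_flow.
Qed.

(** The zeros of an invariant measure contain all their predecessors, so one
    zero would make [pi] vanish identically. *)
Lemma stationary_gt0 : (forall x, exit_rate q x <> 0) ->
  forall x, (0 < pi x)%R.
Proof.
move=> e0 x; rewrite lt0r pi_ge0 andbT; apply/negP => /eqP pix0.
have pi0 : [set z | jump_measure z = 0] = setT.
  apply: irr; first by exists x; rewrite /= /jump_measure pix0 mul0e.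
  move=> u v /= v0 puv; have pushv0 := invariant_jump_measure e0 v.
  rewrite v0 in pushv0.
  have /eqP := term_eq0_esum (fun t _ => mule_ge0 (jump_measure_ge0 t)
    (proj1 (stochastic_jump chainP) t v)) pushv0 (I : setT u).
  by rewrite mule_eq0 (gt_eqF puv) orbF => /eqP.
case: piP => _ + _; rewrite esum1 => [/eqP|z _]; first by rewrite eq_sym onee_eq0.
move/seteqP : pi0 => [_ /(_ z I)] /= /eqP; rewrite mule_eq0 => /orP[/eqP//|/eqP ez].
by case: (e0 z).
Qed.

Lemma stationary_flow_balance (A : set S) : (forall x, exit_rate q x <> 0) ->
  \esum_(x in ~` A) \esum_(y in A) (pi x * q x y)%:E =
  \esum_(x in A) \esum_(y in ~` A) (pi x * q x y)%:E.
Proof.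
move=> e0.
have flowE (B C : set S) : (forall x, B x -> ~ C x) ->
    flow p jump_measure B C = \esum_(x in B) \esum_(y in C) (pi x * q x y)%:E.
  move=> BC; apply: eq_esum => x Bx; apply: eq_esum => y Cy.
  by apply: jump_measure_flow => xy; apply: (BC x) => //; rewrite xy.
rewrite -!flowE//; last by move=> x Ax; exact.
apply: flow_balance => //.
- exact: stochastic_jump chainP.
- by case: ergP => _; exact: recurrent_jump.
- exact: jump_measure_ge0.
- by move=> x; rewrite fin_numM// (exit_rate_fin chainP).
- exact: invariant_jump_measure.
Qed.

End StationaryFlow.

(** * Termination rates *)

Section TerminationAlgebra.
Context {R : realType} {S : countType} (q : S -> S -> R) (pi : S -> R).
Context (A : set S).
Hypothesis rate_ge0 : forall x y, x <> y -> (0 <= q x y)%R.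
Hypothesis exit_fin : forall x, exit_rate q x < +oo.
Hypothesis pi_gt0 : forall x, (0 < pi x)%R.
Hypothesis pi_sum1 : \esum_(x in [set: S]) (pi x)%:E = 1.
Hypothesis A_proper : A <> setT.
Hypothesis balance :
  \esum_(x in ~` A) \esum_(y in A) (pi x * q x y)%:E =
  \esum_(x in A) \esum_(y in ~` A) (pi x * q x y)%:E.
Hypothesis inflow_fin : total_inflow q pi A < +oo.

Let w : \bar R := \esum_(i in ~` A) (pi i)%:E.

Let out_ge0 x y : A x -> (~` A) y -> (0 <= q x y)%R.
Proof. by move=> Ax nAy; apply: rate_ge0 => xy; apply: nAy; rewrite -xy. Qed.

Let in_ge0 x y : A x -> (~` A) y -> (0 <= q y x)%R.
Proof. by move=> Ax nAy; apply: rate_ge0 => xy; apply: nAy; rewrite xy. Qed.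

Let boundaryA k : boundary q A k -> A k. Proof. by case. Qed.

Let w_gt0 : 0 < w.
Proof.
have [z nAz] : exists z, ~ A z.
  apply: contrapT => /forallNP allA; apply: A_proper.
  by apply/seteqP; split=> // x _; exact: contrapT.
apply: (esum_gt0 (i := z)) => //; first by move=> x _; rewrite lee_fin ltW.
by rewrite lte_fin.
Qed.

Let w_fin : w \is a fin_num.
Proof.
rewrite ge0_fin_numE ?ltW//; apply: (le_lt_trans _ (ltry 1%R)).
rewrite -pi_sum1 [leRHS](esumID (~` A)); last by move=> x _; rewrite lee_fin ltW.
by rewrite setTI leeDl//; apply: esum_ge0 => x _; rewrite lee_fin ltW.
Qed.

Let fw_gt0 : (0 < fine w)%R.
Proof. by rewrite fine_gt0// w_gt0 ltey_eq w_fin. Qed.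

Lemma inflow_ge0 k : A k -> 0 <= inflow q pi A k.
Proof.
move=> Ak; apply: esum_ge0 => m nAm.
by rewrite lee_fin mulr_ge0 ?in_ge0// divr_ge0 ?ltW.
Qed.

Lemma outflow_ge0 k : A k -> 0 <= outflow_rate q A k.
Proof. by move=> Ak; apply: esum_ge0 => m nAm; rewrite lee_fin out_ge0. Qed.

Lemma outflow_fin k : A k -> outflow_rate q A k \is a fin_num.
Proof.
move=> Ak; rewrite ge0_fin_numE ?outflow_ge0//; apply: le_lt_trans (exit_fin k).
rewrite [leLHS]esum_mkcond [leRHS]esum_mkcond; apply: le_esum => m _.
case: ifPn => [/set_mem nAm|_]; case: ifPn => //.
- by move=> /negP[]; apply/mem_set => /= mk; apply: nAm; rewrite mk.
- by move=> /set_mem mk; rewrite lee_fin rate_ge0//; exact: nesym.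
Qed.

Lemma inflowE k : A k ->
  \esum_(m in ~` A) (pi m * q m k)%:E = (fine w)%:E * inflow q pi A k.
Proof.
move=> Ak; rewrite -ge0_esum_distrr; last 2 first.
- by rewrite lee_fin ltW.
- by move=> m nAm; rewrite lee_fin mulr_ge0 ?in_ge0// divr_ge0 ?ltW.
apply: eq_esum => m nAm; rewrite -EFinM /correct_dist -/w mulrA; congr (_ * _)%:E.
by rewrite mulrCA divff ?mulr1// gt_eqF.
Qed.

(** States of [A] off the boundary carry no flow across the cut, so sums over
    [A] reduce to sums over the boundary. *)
Let off_boundary k m : A k -> ~ boundary q A k -> (~` A) m ->
  q k m = 0%R /\ q m k = 0%R.
Proof.
move=> Ak nbk nAm; have out0 := out_ge0 Ak nAm; have in0 := in_ge0 Ak nAm.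
have : (q k m + q m k)%R = 0%R.
  apply/eqP; rewrite eq_le addr_ge0// andbT leNgt.
  by apply/negP => qkm; apply: nbk; split=> //; exists m.
move/eqP; rewrite paddr_eq0// => /andP[/eqP -> /eqP ->].
by [].
Qed.

Let esum_boundary (f : S -> \bar R) : (forall k, A k -> 0 <= f k) ->
  (forall k, A k -> ~ boundary q A k -> f k = 0) ->
  \esum_(k in A) f k = \esum_(k in boundary q A) f k.
Proof.
move=> f0 fb; rewrite (esumID (boundary q A))//.
rewrite [X in _ + X]esum1 ?adde0 => [|k [Ak nbk]]; last exact: fb.
by congr esum; apply/seteqP; split=> [k []//|k bk]; split=> //; exact: boundaryA.
Qed.

Lemma total_inflowE :
  \esum_(x in ~` A) \esum_(y in A) (pi x * q x y)%:E
  = (fine w)%:E * total_inflow q pi A.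
Proof.
rewrite exchange_esum; last first.
  by move=> x y nAx Ay; rewrite lee_fin mulr_ge0 ?in_ge0// ltW.
rewrite -ge0_esum_distrr ?lee_fin ?(ltW fw_gt0)//; last first.
  by move=> k /boundaryA; exact: inflow_ge0.
rewrite esum_boundary.
- by apply: eq_esum => k /boundaryA Ak; rewrite inflowE.
- move=> k Ak; apply: esum_ge0 => m nAm.
  by rewrite lee_fin mulr_ge0 ?in_ge0// ltW.
- move=> k Ak nbk; apply: esum1 => m nAm.
  by have [_ ->] := off_boundary Ak nbk nAm; rewrite mulr0.
Qed.

(** The flow balance lets the total inflow be read off from the outflow rates;
    this is the sum that appears in the inflow condition. *)
Lemma total_outflowE :
  \esum_(k in boundary q A) ((pi k)%:E * outflow_rate q A k)
  = (fine w)%:E * total_inflow q pi A.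
Proof.
rewrite -total_inflowE balance -esum_boundary.
- apply: eq_esum => k Ak; rewrite -ge0_esum_distrr ?lee_fin ?(ltW (pi_gt0 k))//.
  by move=> m nAm; rewrite lee_fin out_ge0.
- by move=> k Ak; rewrite mule_ge0 ?outflow_ge0// lee_fin ltW.
- move=> k Ak nbk; rewrite /outflow_rate esum1 ?mule0// => m nAm.
  by have [-> _] := off_boundary Ak nbk nAm.
Qed.

(** A boundary state has a positive rate from or to the complement.  In the
    second case the outflow is positive, hence so is the inflow by balance.  The
    proportions are therefore genuine quotients. *)
Lemma total_inflow_gt0 k : boundary q A k -> 0 < total_inflow q pi A.
Proof.
move=> bk; have Ak := boundaryA bk.
suff : 0 < (fine w)%:E * total_inflow q pi A.
  by rewrite pmule_rgt0// lte_fin.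
case: (bk) => _ [m [nAm]].
have := out_ge0 Ak nAm; rewrite le_eqVlt => /predU1P[<-|qkm _].
  rewrite add0r => qmk; rewrite -total_inflowE.
  apply: (esum_gt0 (i := m)) => // [x nAx|].
    by apply: esum_ge0 => y Ay; rewrite lee_fin mulr_ge0 ?in_ge0// ltW.
  apply: (esum_gt0 (i := k)) => // [y Ay|].
    by rewrite lee_fin mulr_ge0 ?in_ge0// ltW.
  by rewrite lte_fin mulr_gt0.
rewrite -total_inflowE balance.
apply: (esum_gt0 (i := k)) => // [x Ax|].
  by apply: esum_ge0 => y nAy; rewrite lee_fin mulr_ge0 ?out_ge0// ltW.
apply: (esum_gt0 (i := m)) => // [y nAy|].
  by rewrite lee_fin mulr_ge0 ?out_ge0// ltW.
by rewrite lte_fin mulr_gt0.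
Qed.

Lemma inflow_boundary_fin k : boundary q A k -> inflow q pi A k \is a fin_num.
Proof.
move=> bk; rewrite ge0_fin_numE ?inflow_ge0//; last exact: boundaryA.
by apply: le_lt_trans inflow_fin; exact: term_le_esum.
Qed.

Lemma total_inflow_mulV k : boundary q A k ->
  total_inflow q pi A * (fine (total_inflow q pi A))^-1%:E = 1.
Proof.
move=> /total_inflow_gt0 T0; rewrite -[X in X * _]fineK; last first.
  by rewrite ge0_fin_numE// ltW.
by rewrite -EFinM divff// gt_eqF// fine_gt0// T0.
Qed.

Lemma termination_outflow k : boundary q A k ->
  \esum_(k' in ~` A) (q k k')%:E
  = \esum_(k' in boundary q A) (termination_rate q pi A k k')%:E.
Proof.
move=> bk; have Ak := boundaryA bk; have T0 := total_inflow_gt0 bk.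
set t := fine (total_inflow q pi A).
have c0 : 0 <= outflow_rate q A k * t^-1%:E.
  by rewrite mule_ge0 ?outflow_ge0// lee_fin invr_ge0 fine_ge0// ltW.
transitivity (\esum_(k' in boundary q A)
    (outflow_rate q A k * t^-1%:E * inflow q pi A k')).
  rewrite ge0_esum_distrr//; last by move=> m /boundaryA; exact: inflow_ge0.
  by rewrite -muleA [X in _ * X]muleC (total_inflow_mulV bk) mule1.
apply: eq_esum => m bm; rewrite /termination_rate /inflow_proportion -/t.
rewrite !EFinM !fineK ?outflow_fin ?inflow_boundary_fin//.
by rewrite -muleA [X in _ * X]muleC.
Qed.

Lemma termination_inflow k : boundary q A k ->
  \esum_(k' in ~` A) (pi k' * q k' k)%:E
  = \esum_(k' in boundary q A) (pi k' * termination_rate q pi A k' k)%:E.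
Proof.
move=> bk; have Ak := boundaryA bk; have T0 := total_inflow_gt0 bk.
set t := fine (total_inflow q pi A).
have c0 : 0 <= inflow q pi A k * t^-1%:E.
  by rewrite mule_ge0 ?inflow_ge0// lee_fin invr_ge0 fine_ge0// ltW.
transitivity (\esum_(k' in boundary q A)
    ((pi k')%:E * outflow_rate q A k' * (inflow q pi A k * t^-1%:E))).
  rewrite ge0_esum_distrl//; last first.
    move=> m /boundaryA Am.
    by rewrite mule_ge0 ?outflow_ge0// lee_fin ltW.
  rewrite total_outflowE inflowE// [inflow q pi A k * _]muleC muleA.
  by rewrite -[(fine w)%:E * _ * _]muleA (total_inflow_mulV bk) mule1.
apply: eq_esum => m bm; rewrite /termination_rate /inflow_proportion -/t.
rewrite !EFinM !fineK ?outflow_fin ?inflow_boundary_fin//; last exact: boundaryA.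
by rewrite !muleA.
Qed.

End TerminationAlgebra.

Theorem corollary1 (R : realType) (S : countType) (q : S -> S -> R)
    (d : measure_display) (Omega : measurableType d)
    (P : S -> probability Omega R) (Y : nat -> Omega -> S)
    (H : nat -> Omega -> \bar R) (pi : S -> R) (A : set S)
    (chainP : is_ctmc q P Y H)
    (ergP : ergodic q P Y H)
    (piP : stationary_distribution q pi)
    (A_nonempty : A !=set0) (A_proper : A <> [set: S])
    (inflow_fin : total_inflow q pi A < +oo) :
  [/\ forall k, boundary q A k ->
        \esum_(k' in ~` A) (q k k')%:E
        = \esum_(k' in boundary q A) (termination_rate q pi A k k')%:E,
      forall k, boundary q A k ->
        \esum_(k' in ~` A) (pi k' * q k' k)%:E
        = \esum_(k' in boundary q A)
            (pi k' * termination_rate q pi A k' k)%:E &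
      forall k, boundary q A k ->
        (pi k)%:E * (\esum_(k' in ~` A) (q k k')%:E)
        - \esum_(k' in ~` A) (pi k' * q k' k)%:E
        = (pi k)%:E *
            (\esum_(k' in boundary q A) (termination_rate q pi A k k')%:E)
          - \esum_(k' in boundary q A)
              (pi k' * termination_rate q pi A k' k)%:E].
Proof.
(* [A] and its complement are nonempty, so there are at least two states. *)
have [e0|] := pselect (forall x, exit_rate q x <> 0); last first.
  have [a Aa] := A_nonempty.
  have [b nAb] : exists b, ~ A b.
    apply: contrapT => /forallNP allA; apply: A_proper.
    by apply/seteqP; split=> // x _; exact: contrapT.
  case=> x; have [->|/eqP xa] := eqVneq x a.
    by apply: (exit_rate_neq0 chainP ergP (y := b)) => ab; apply: nAb; rewrite -ab.
  exact: (exit_rate_neq0 chainP ergP xa).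
have [[rate_ge0 exit_fin] _ _ _ _] := chainP.
have [_ pi_sum1 _] := piP.
have pi_gt0 := stationary_gt0 chainP ergP piP e0.
have balance := stationary_flow_balance chainP ergP piP A e0.
have outflowP k (bk : boundary q A k) :=
  termination_outflow rate_ge0 exit_fin pi_gt0 pi_sum1 A_proper balance
    inflow_fin bk.
have inflowP k (bk : boundary q A k) :=
  termination_inflow rate_ge0 exit_fin pi_gt0 pi_sum1 A_proper balance
    inflow_fin bk.
by split=> // k bk; rewrite outflowP// inflowP.
Qed.
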